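(* Let $\ell(t)$ be a fanning curve in the Grassmannian $\mathrm{G}_n$ of $n$-dimensional subspaces of $\mathbb{R}^{2n}$ and let $h(t)$ be its horizontal curve. The Jacobi endomorphism $\mathbf{K}(t)$ of $\ell(t)$ satisfies the following properties: 1. At each time $t$ the endomorphism $\mathbf{K}(t)$ preserves the decomposition $\mathbb{R}^{2n}=\ell(t)\oplus h(t)$ (i.e. maps each summand into itself). 2. If $\mathbf{T}$ is an invertible linear map from $\mathbb{R}^{2n}$ to itself, the Jacobi endomorphism of $\mathbf{T}\ell(t)$ is $\mathbf{T}\mathbf{K}(t)\mathbf{T}^{-1}$. 3. If $s$ is a diffeomorphism of the real line and $\{s(t),t\}$ denotes its Schwarzian derivative, the Jacobi endomorphism of the curve $t\mapsto\ell(s(t))$ is $$\mathbf{K}(s(t))\,\dot s(t)^2+\tfrac12\{s(t),t\}\,\mathbf{I}.$$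
   Context: For $2n\times n$ matrices $\mathcal{A},\mathcal{B}$, $(\mathcal{A}|\mathcal{B})$ is the $2n\times 2n$ matrix obtained by juxtaposition. A fanning frame is a smooth curve $\mathcal{A}(t)$, $t\in\mathbb{R}$, of real $2n\times n$ matrices such that $(\mathcal{A}(t)|\dot{\mathcal{A}}(t))$ is invertible for all $t$. A fanning curve in $\mathrm{G}_n$ is a smooth curve $\ell(t)$ that is the column span of a fanning frame (two fanning frames span the same curve iff they differ by right multiplication by a smooth curve of invertible $n\times n$ matrices). The fundamental endomorphism of $\ell(t)$ is the curve $\mathbf{F}(t)$ of $2n\times 2n$ matrices determined by $\mathbf{F}(t)\mathcal{A}(t)=O$, $\mathbf{F}(t)\dot{\mathcal{A}}(t)=\mathcal{A}(t)$ for any fanning frame $\mathcal{A}(t)$ spanning $\ell(t)$ (it does not depend on the frame). One has $\dot{\mathbf{F}}(t)^2=\mathbf{I}$, with $-1$ eigenspace $\ell(t)$; the horizontal curve $h(t)$ is the $+1$ eigenspace of $\dot{\mathbf{F}}(t)$, i.e. the kernel of $\mathbf{P}(t)=(\mathbf{I}-\dot{\mathbf{F}}(t))/2$. The Jacobi endomorphism of $\ell(t)$ is $\mathbf{K}(t)=\ddot{\mathbf{F}}(t)^2/4=\dot{\mathbf{P}}(t)^2$. The Schwarzian derivative of $s$ is $\{s(t),t\}=\dddot{s}/\dot s-\tfrac32(\ddot s/\dot s)^2$. *)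

(* Defs.v *)
From HB Require Import structures.
From mathcomp Require Import all_boot all_order all_algebra.
From mathcomp Require Import all_classical all_reals all_analysis.

Set Implicit Arguments.
Unset Strict Implicit.
Unset Printing Implicit Defensive.

Import Order.TTheory GRing.Theory Num.Theory numFieldNormedType.Exports.

Local Open Scope ring_scope.
Local Open Scope classical_set_scope.

Definition smooth (R : realType) (V : normedModType R) (f : R -> V) : Prop :=
  forall (k : nat) (t : R), derivable (derive1n k f) t 1.

(* Matrices act on column vectors, from the left. *)
Definition mxhom (R : realType) (m n : nat) (M : 'M[R]_(m, n)) :
    'Hom('cV[R]_n, 'cV[R]_m) :=
  linfun (mulmx M).

Definition colspan (R : realType) (m n : nat) (M : 'M[R]_(m, n)) :
    {vspace 'cV[R]_m} :=
  limg (mxhom M).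

Definition fanning_frame (R : realType) (n : nat) (A : R -> 'M[R]_(n + n, n)) :
    Prop :=
  smooth A /\ forall t, row_mx (A t) (derive1 A t) \in unitmx.

Definition frame_of (R : realType) (n : nat)
    (l : R -> {vspace 'cV[R]_(n + n)}) (A : R -> 'M[R]_(n + n, n)) : Prop :=
  fanning_frame A /\ forall t, l t = colspan (A t).

(* A curve in the Grassmannian of n-dimensional subspaces of R^(2n): the
   columns of an invertible (A t | A' t) are independent, so \dim (l t) = n. *)
Definition fanning_curve (R : realType) (n : nat)
    (l : R -> {vspace 'cV[R]_(n + n)}) : Prop :=
  exists A, frame_of l A.

(* The condition characterizes a unique matrix when l is a fanning curve;
   the value is irrelevant for other curves. *)
Definition fundamental (R : realType) (n : nat)
    (l : R -> {vspace 'cV[R]_(n + n)}) (t : R) : 'M[R]_(n + n) :=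
  xget 0 [set F : 'M[R]_(n + n) |
    forall A, frame_of l A -> F *m A t = 0 /\ F *m derive1 A t = A t].

Definition vertical_proj (R : realType) (n : nat)
    (l : R -> {vspace 'cV[R]_(n + n)}) (t : R) : 'M[R]_(n + n) :=
  2^-1 *: (1%:M - derive1 (fundamental l) t).

Definition horizontal (R : realType) (n : nat)
    (l : R -> {vspace 'cV[R]_(n + n)}) (t : R) : {vspace 'cV[R]_(n + n)} :=
  lker (mxhom (vertical_proj l t)).

Definition jacobi (R : realType) (n : nat)
    (l : R -> {vspace 'cV[R]_(n + n)}) (t : R) : 'M[R]_(n + n) :=
  4^-1 *: (derive1n 2 (fundamental l) t *m derive1n 2 (fundamental l) t).

Definition diffeomorphism (R : realType) (s : R -> R) : Prop :=
  smooth s /\ exists g : R -> R, [/\ smooth g, cancel s g & cancel g s].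

Definition schwarzian (R : realType) (s : R -> R) (t : R) : R :=
  derive1n 3 s t / derive1 s t
    - 3 / 2 * (derive1n 2 s t / derive1 s t) ^+ 2.

(* Main.v *)
Require Import Defs.
From HB Require Import structures.
From mathcomp Require Import all_boot all_order all_algebra.
From mathcomp Require Import all_classical all_reals all_analysis.
From mathcomp Require Import ring.

Set Implicit Arguments.
Unset Strict Implicit.
Unset Printing Implicit Defensive.

Import Order.TTheory GRing.Theory Num.Theory numFieldNormedType.Exports.

Local Open Scope ring_scope.

(* The fundamental endomorphism is F = (O|A)(A|A')^-1 for any frame A.
   Differentiating F A = O and F A' = A gives F' A = -A, hence
     F^2 = O,  F' F = -F,  F F' = F,  F'^2 = I,
   and, after one more differentiation,
     F'' F = -F' - I,  F F'' = F' - I,  F'' F' = -F' F''.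
   The last relation makes F''^2 commute with F', hence with P, and
   2 P = I - F' = -F F'' shows that l is the image of P.  T l has fundamental
   endomorphism T F T^-1, and l o s has F(s) / s'; squaring the second derivative
   of the latter by means of the relations above produces the Schwarzian. *)

(** * Smoothness of finite order and its closure properties *)

Section finite_smoothness.
Variable R : realType.

(* C^k by recursion on k: unlike [smooth], a class in which closure properties
   follow by induction from the differentiation rules. *)
Fixpoint ck (k : nat) (V : normedModType R) (f : R -> V) : Prop :=
  if k is j.+1 then (forall t, derivable f t 1) /\ ck j (derive1 f) else True.

(** The derivative of order [k.+1] of [f] is that of order [k] of [derive1 f], so both inductions
    run with [f] generalized. *)
Lemma smoothP (V : normedModType R) (f : R -> V) :
  smooth f <-> forall k, ck k f.
Proof.
split=> [sf k|cf k t].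
  elim: k f sf => [//|k IH] f sf /=; split=> [t|]; first exact: sf 0%N t.
  by apply: IH => j t; rewrite -derive1Sn; exact: sf.
elim: k f cf => [|k IH] f cf; first by have [+ _] := cf 1%N; apply.
by rewrite derive1Sn; apply: IH => j; have [] := cf j.+1.
Qed.

Lemma smooth_ck k (V : normedModType R) (f : R -> V) : smooth f -> ck k f.
Proof. by move=> /smoothP. Qed.

(** The introduction rule for [ck]: a closed form [g] of the derivative is supplied, and the
    induction hypothesis of each closure lemma then applies to [g]. *)
Lemma ck_derive1 k (V : normedModType R) (f g : R -> V) :
  (forall t : R, is_derive t 1 f (g t)) -> ck k g -> ck k.+1 f.
Proof.
move=> df cg; split=> [t|]; first exact: ex_derive.
suff -> : derive1 f = g by [].
by apply/funext => t; rewrite derive1E derive_val.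
Qed.

Lemma is_derive_derive1 (V : normedModType R) (f : R -> V) (t : R) :
  derivable f t 1 -> is_derive t 1 f (derive1 f t).
Proof. by rewrite derive1E => /derivableP. Qed.

Lemma ck_is_derive k (V : normedModType R) (f : R -> V) :
  ck k.+1 f -> forall t : R, is_derive t 1 f (derive1 f t).
Proof. by move=> [df _] t; exact: is_derive_derive1. Qed.

Lemma ckW k (V : normedModType R) (f : R -> V) : ck k.+1 f -> ck k f.
Proof.
elim: k f => [//|k IH] f [df cf]; split=> //; exact: IH.
Qed.

Lemma ck_cst k (V : normedModType R) (c : V) : ck k (fun=> c).
Proof.
by elim: k V c => [//|k IH] V c; apply: (ck_derive1 (g := fun=> 0)).
Qed.

Lemma ckD k (V : normedModType R) (f g : R -> V) :
  ck k f -> ck k g -> ck k (fun t => f t + g t).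
Proof.
elim: k f g => [//|k IH] f g cf cg.
apply: (ck_derive1 (g := fun t => derive1 f t + derive1 g t)).
  by move=> t; apply: is_deriveD; [exact: (ck_is_derive cf)|exact: (ck_is_derive cg)].
by apply: IH; [case: cf|case: cg].
Qed.

(** Leibniz rule with the factors kept in order, the form that carries over to matrix products. *)
Lemma is_derive_mul (f g : R -> R) (t df dg : R) :
  is_derive t 1 f df -> is_derive t 1 g dg ->
  is_derive t 1 (fun x => f x * g x) (df * g t + f t * dg).
Proof.
move=> hf hg; rewrite addrC [df * _]mulrC.
exact: (is_deriveM hf hg).
Qed.

Lemma is_derive_big_sum I (r : seq I) (F : I -> R -> R) (t : R) dF :
  (forall i, is_derive t 1 (F i) (dF i)) ->
  is_derive t 1 (fun x => \sum_(i <- r) F i x) (\sum_(i <- r) dF i).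
Proof.
move=> hF; elim: r => [|i r IH].
  by rewrite big_nil; under eq_fun do rewrite big_nil; exact: is_derive_cst.
rewrite big_cons; under eq_fun do rewrite big_cons.
exact: is_deriveD.
Qed.

Lemma ckM k (f g : R -> R) : ck k f -> ck k g -> ck k (fun t => f t * g t).
Proof.
elim: k f g => [//|k IH] f g cf cg.
have dfg (t : R) := is_derive_mul (ck_is_derive cf t) (ck_is_derive cg t).
apply: (ck_derive1 dfg).
(* Each term of f'g + fg' has an undifferentiated factor, whose order is lowered by [ckW]. *)
by apply: ckD; apply: IH; [case: cf|exact: ckW|exact: ckW|case: cg].
Qed.

Lemma is_deriveV (f : R -> R) (t df : R) : f t != 0 -> is_derive t 1 f df ->
  is_derive t 1 (fun x => (f x)^-1) (- (f t) ^- 2 * df).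
Proof.
move=> ft0 dft; apply: DeriveDef.
  by apply: derivableV => //; exact: ex_derive.
by rewrite deriveV ?derive_val //; exact: ex_derive.
Qed.

Lemma ckV k (f : R -> R) :
  (forall t, f t != 0) -> ck k f -> ck k (fun t => (f t)^-1).
Proof.
move=> f0; elim: k => [//|k IH] cf.
(* The derivative of 1/f is a product of 1/f and f', both of class one order lower, so the induction
   closes. *)
apply: (@ck_derive1 _ _ _ (fun t => -1 * ((f t)^-1 * (f t)^-1 * derive1 f t))).
  move=> t; apply: is_derive_eq; first by apply: is_deriveV; [|exact: (ck_is_derive cf)].
  by rewrite expr2 invfM mulN1r mulNr.
have cV := IH (ckW cf).
by do !apply: ckM => //; [exact: ck_cst|case: cf].
Qed.

Lemma ck_comp k (f s : R -> R) : ck k f -> ck k s -> ck k (fun t => f (s t)).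
Proof.
elim: k f => [//|k IH] f cf cs.
have dfs (t : R) := is_derive1_comp (ck_is_derive cf (s t)) (ck_is_derive cs t).
apply: (ck_derive1 dfs).
by apply: ckM; [apply: IH; [case: cf|exact: ckW]|case: cs].
Qed.

Lemma ck_sum k I (r : seq I) (P : pred I) (f : I -> R -> R) :
  (forall i, ck k (f i)) -> ck k (fun t => \sum_(i <- r | P i) f i t).
Proof.
move=> cf; elim: r => [|i r IH].
  by under eq_fun do rewrite big_nil; exact: ck_cst.
by under eq_fun do rewrite big_cons; case: (P i) => //; exact: ckD.
Qed.

Lemma ck_prod k I (r : seq I) (P : pred I) (f : I -> R -> R) :
  (forall i, ck k (f i)) -> ck k (fun t => \prod_(i <- r | P i) f i t).
Proof.
move=> cf; elim: r => [|i r IH].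
  by under eq_fun do rewrite big_nil; exact: ck_cst.
by under eq_fun do rewrite big_cons; case: (P i) => //; exact: ckM.
Qed.

(** * Entrywise calculus of matrix-valued curves *)

Lemma is_derive_mxP m n (M : R -> 'M[R]_(m, n)) (t : R) (dM : 'M[R]_(m, n)) :
  is_derive t 1 M dM <->
  forall i j, is_derive t 1 (fun x => M x i j) (dM i j).
Proof.
split=> [H i j|H].
  have dM1 : derivable M t 1 by exact: ex_derive.
  apply: DeriveDef; first exact: (derivable_mxP _ _ _).1 dM1 i j.
  by rewrite -(@derive_val _ _ _ _ _ _ _ H) derive_mx // mxE.
have dM1 : derivable M t 1 by apply/derivable_mxP => i j; exact: ex_derive.
apply: DeriveDef => //; rewrite derive_mx //.
by apply/matrixP => i j; rewrite mxE derive_val.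
Qed.

Lemma ck_mxP k m n (M : R -> 'M[R]_(m, n)) :
  ck k M <-> forall i j, ck k (fun t => M t i j).
Proof.
elim: k M => [//|k IH] M; split=> [cM i j|cM].
  apply: (@ck_derive1 _ _ _ (fun t => derive1 M t i j)) => [t|].
    by have /is_derive_mxP := ck_is_derive cM t.
  by case: cM => _ /IH.
apply: (@ck_derive1 _ _ _ (fun t => \matrix_(i, j) derive1 (fun x => M x i j) t)).
  move=> t; apply/is_derive_mxP => i j; rewrite mxE; exact: (ck_is_derive (cM i j)).
apply/IH => i j; under eq_fun do rewrite mxE.
by case: (cM i j).
Qed.

Lemma ck_mulmx k m n p (M : R -> 'M[R]_(m, n)) (N : R -> 'M[R]_(n, p)) :
  ck k M -> ck k N -> ck k (fun t => M t *m N t).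
Proof.
move=> /ck_mxP cM /ck_mxP cN; apply/ck_mxP => i j.
by under eq_fun do rewrite mxE; apply: ck_sum => a; exact: ckM.
Qed.

Lemma ck_row_mx k m n p (M : R -> 'M[R]_(m, n)) (N : R -> 'M[R]_(m, p)) :
  ck k M -> ck k N -> ck k (fun t => row_mx (M t) (N t)).
Proof.
move=> /ck_mxP cM /ck_mxP cN; apply/ck_mxP => i j.
by under eq_fun do rewrite mxE; case: (fintype.split j).
Qed.

Lemma ck_det k n (M : R -> 'M[R]_n) : ck k M -> ck k (fun t => \det (M t)).
Proof.
move=> /ck_mxP cM; apply: ck_sum => s; apply: ckM; first exact: ck_cst.
by apply: ck_prod => i; exact: cM.
Qed.

(** By Cramer's rule each entry of the inverse is a cofactor divided by the determinant, which never
    vanishes. *)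
Lemma ck_invmx k n (M : R -> 'M[R]_n) : (forall t, M t \in unitmx) ->
  ck k M -> ck k (fun t => invmx (M t)).
Proof.
move=> uM cM; apply/ck_mxP => i j.
under eq_fun => t do rewrite /invmx uM !mxE /cofactor.
apply: ckM.
  by apply: ckV => [t|]; [rewrite -unitfE -unitmxE|exact: ck_det].
apply: ckM; first exact: ck_cst.
apply: ck_det; apply/ck_mxP => a b; under eq_fun do rewrite !mxE.
by move/ck_mxP : cM; apply.
Qed.

Lemma is_derive_mulmx m n p (M : R -> 'M[R]_(m, n)) (N : R -> 'M[R]_(n, p))
    (t : R) dM dN :
  is_derive t 1 M dM -> is_derive t 1 N dN ->
  is_derive t 1 (fun x => M x *m N x) (dM *m N t + M t *m dN).
Proof.
move=> /is_derive_mxP hM /is_derive_mxP hN; apply/is_derive_mxP => i j.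
rewrite !mxE -big_split /=.
under eq_fun do rewrite mxE; apply: is_derive_big_sum => a.
exact: is_derive_mul (hM i a) (hN a j).
Qed.

Lemma is_derive_mulmxl m n p (C : 'M[R]_(m, n)) (M : R -> 'M[R]_(n, p))
    (t : R) dM :
  is_derive t 1 M dM -> is_derive t 1 (fun x => C *m M x) (C *m dM).
Proof.
move=> hM; rewrite -[C *m dM]add0r -(mul0mx _ (M t)).
exact: is_derive_mulmx (is_derive_cst C t 1) hM.
Qed.

Lemma is_derive_mulmxr m n p (M : R -> 'M[R]_(m, n)) (C : 'M[R]_(n, p))
    (t : R) dM :
  is_derive t 1 M dM -> is_derive t 1 (fun x => M x *m C) (dM *m C).
Proof.
move=> hM; rewrite -[dM *m C]addr0 -(mulmx0 _ (M t)).
exact: is_derive_mulmx hM (is_derive_cst C t 1).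
Qed.

Lemma is_derive_scalemx m n (f : R -> R) (M : R -> 'M[R]_(m, n)) (t df : R) dM :
  is_derive t 1 f df -> is_derive t 1 M dM ->
  is_derive t 1 (fun x => f x *: M x) (df *: M t + f t *: dM).
Proof.
move=> hf /is_derive_mxP hM; apply/is_derive_mxP => i j.
under eq_fun do rewrite mxE; rewrite !mxE.
exact: is_derive_mul hf (hM i j).
Qed.

Lemma is_derive_comp_mx m n (M : R -> 'M[R]_(m, n)) (s : R -> R) (t : R) dM ds :
  is_derive (s t) 1 M dM -> is_derive t 1 s ds ->
  is_derive t 1 (fun x => M (s x)) (ds *: dM).
Proof.
move=> /is_derive_mxP hM hs; apply/is_derive_mxP => i j.
apply: is_derive_eq; first exact: is_derive1_comp (hM i j) hs.
by rewrite mxE mulrC.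
Qed.

Lemma smooth_is_derive (V : normedModType R) (f : R -> V) : smooth f ->
  forall t : R, is_derive t 1 f (derive1 f t).
Proof. by move=> sf t; apply: is_derive_derive1; exact: sf 0%N t. Qed.

Lemma smooth_derive1 (V : normedModType R) (f : R -> V) :
  smooth f -> smooth (derive1 f).
Proof. by move=> sf k t; rewrite -derive1Sn; exact: sf. Qed.

(** Most identities below come from this lemma: one curve is differentiated in two ways and the
    results are compared. *)
Lemma is_derive_uniq (V : normedModType R) (f : R -> V) (t : R) a b :
  is_derive t 1 f a -> is_derive t 1 f b -> a = b.
Proof. by move=> ha hb; rewrite -(@derive_val _ _ _ _ _ _ _ ha) derive_val. Qed.

Lemma derive1_is_derive (V : normedModType R) (f : R -> V) (t : R) a :
  is_derive t 1 f a -> derive1 f t = a.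
Proof. by move=> ha; rewrite derive1E derive_val. Qed.

End finite_smoothness.

(** * Fanning frames and the fundamental endomorphism *)

Section fanning.
Variables (R : realType) (n : nat).
Implicit Types (l : R -> {vspace 'cV[R]_(n + n)}) (A B : R -> 'M[R]_(n + n, n)).
Implicit Types (t : R).

Lemma scale_half_double (V : lmodType R) (v : V) : 2^-1 *: (v + v) = v.
Proof.
by rewrite -mulr2n -(scaler_nat 2 v) scalerA mulVf ?scale1r ?pnatr_eq0.
Qed.

Lemma mxhomE m p (M : 'M[R]_(m, p)) v : mxhom M v = M *m v.
Proof. by rewrite lfunE. Qed.

Lemma memv_colspanP m p (M : 'M[R]_(m, p)) v :
  reflect (exists w, v = M *m w) (v \in colspan M).
Proof.
apply: (iffP memv_imgP) => [[w _ ->]|[w ->]]; exists w; rewrite ?memvf //.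
all: by rewrite mxhomE.
Qed.

Lemma colspan_mulmx m p q (M : 'M[R]_(m, p)) (N : 'M[R]_(p, q)) :
  colspan (M *m N) = (mxhom M @: colspan N)%VS.
Proof.
rewrite /colspan -limg_comp; congr lfun_img.
by apply/lfunP => v; rewrite comp_lfunE !mxhomE mulmxA.
Qed.

(* X is the upper half of (A|A')^-1 B, which makes it smooth; the span condition
   alone gives X only pointwise. *)
Lemma frame_change l A B : frame_of l A -> frame_of l B ->
  exists2 X : R -> 'M[R]_n, smooth X & forall t, B t = A t *m X t.
Proof.
move=> [[sA uA] lA] [[sB _] lB].
pose V t := invmx (row_mx (A t) (derive1 A t)).
exists (fun t => usubmx (V t) *m B t) => [|t].
  apply/smoothP => k; apply: ck_mulmx; last exact: smooth_ck sB.
  apply/ck_mxP => i j; under eq_fun do rewrite mxE.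
  (* An entry of the upper half is an entry of [V]; generalizing its indices reduces the goal to the
     smoothness of [V]. *)
  move: (lshift n i) j; apply/ck_mxP; apply: ck_invmx; first exact: uA.
  by apply: ck_row_mx; [exact: smooth_ck sA|exact: smooth_ck (smooth_derive1 sA)].
(* The upper left block of V(A|A') = I: the upper half of [V] is a left inverse of [A t]. *)
have VA : usubmx (V t) *m A t = 1%:M.
  have := mulVmx (uA t); rewrite -/(V t) -[X in X *m _](vsubmxK (V t)) mul_col_row.
  by rewrite scalar_mx_block => /eq_block_mx[].
apply/matrixP => i j.
have /memv_colspanP[w Bw] : col j (B t) \in colspan (A t).
  rewrite -lA lB; apply/memv_colspanP; exists (delta_mx j 0).
  by rewrite colE.
suff E : col j (B t) = col j (A t *m (usubmx (V t) *m B t)).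
  by move/colP : E => /(_ i); rewrite !mxE.
by rewrite !colE -!mulmxA -colE Bw [usubmx _ *m _]mulmxA VA mul1mx.
Qed.

(** The columns of (A|A') form a basis, so a linear map is determined by its values on A and A'. *)
Lemma fanning_frame_cancel A m (M N : 'M[R]_(m, n + n)) t :
  fanning_frame A -> M *m A t = N *m A t ->
  M *m derive1 A t = N *m derive1 A t -> M = N.
Proof.
move=> [_ uA] MA MA'; apply: (can_inj (mulmxK (uA t))).
by rewrite !mul_mx_row MA MA'.
Qed.

(** One frame suffices: for B = AX one has B' = A'X + AX', whence FB = 0 and FB' = AX = B.
    Cancellation against (A|A') gives the uniqueness that [xget] requires. *)
Lemma fundamental_unique l A t (F : 'M[R]_(n + n)) : frame_of l A ->
  F *m A t = 0 -> F *m derive1 A t = A t -> fundamental l t = F.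
Proof.
move=> lA FA FA'; apply: xget_unique => [B lB|G /(_ A lA)[GA GA']]; last first.
  have [fA _] := lA.
  by apply: (fanning_frame_cancel fA (t := t)); rewrite ?GA ?GA'.
have [X sX BX] := frame_change lA lB.
have dB : derive1 B t = derive1 A t *m X t + A t *m derive1 X t.
  apply: derive1_is_derive; rewrite (_ : B = fun t => A t *m X t); last exact/funext.
  have [[sA _] _] := lA.
  exact: is_derive_mulmx (smooth_is_derive sA t) (smooth_is_derive sX t).
split; first by rewrite BX mulmxA FA mul0mx.
by rewrite dB mulmxDr !mulmxA FA FA' mul0mx addr0 BX.
Qed.

Lemma fundamental_frameE l A t : frame_of l A ->
  fundamental l t = row_mx 0 (A t) *m invmx (row_mx (A t) (derive1 A t)).
Proof.
move=> lA; have [[_ /(_ t) uA] _] := lA.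
set F := RHS; have /eq_row_mx[FA FA'] : row_mx (F *m A t) (F *m derive1 A t) =
    row_mx 0 (A t) by rewrite -mul_mx_row mulmxKV.
exact: fundamental_unique lA FA FA'.
Qed.

Lemma fundamental_frame l A t : frame_of l A ->
  fundamental l t *m A t = 0 /\ fundamental l t *m derive1 A t = A t.
Proof.
move=> lA; rewrite (fundamental_frameE _ lA); have [[_ /(_ t) uA] _] := lA.
by apply: eq_row_mx; rewrite -mul_mx_row mulmxKV.
Qed.

Lemma smooth_fundamental l : fanning_curve l -> smooth (fundamental l).
Proof.
move=> [A lA]; have [[sA uA] _] := lA.
rewrite (_ : fundamental l =
    fun t => row_mx 0 (A t) *m invmx (row_mx (A t) (derive1 A t))); last first.
  by apply/funext => t; exact: fundamental_frameE.
apply/smoothP => k; apply: ck_mulmx.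
  by apply: ck_row_mx; [exact: ck_cst|exact: smooth_ck sA].
apply: ck_invmx; first exact: uA.
by apply: ck_row_mx; [exact: smooth_ck sA|exact: smooth_ck (smooth_derive1 sA)].
Qed.

(* [f], [f1], [f2] are F, F', F'' at s(t); [a], [b], [d] are s', s'', s''' at t;
   [g] is the second derivative of F(s(t)) / s'(t). *)
Lemma reparametrized_square m (f f1 f2 : 'M[R]_m) (a b d : R) : a != 0 ->
  f *m f = 0 -> f1 *m f = - f -> f *m f1 = f -> f1 *m f1 = 1%:M ->
  f2 *m f = - f1 - 1%:M -> f *m f2 = f1 - 1%:M -> f2 *m f1 = - (f1 *m f2) ->
  let g := a *: f2 + (- (b / a)) *: f1
    + (- (d / a ^+ 2 - 2 * b ^+ 2 / a ^+ 3)) *: f in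
  4^-1 *: (g *m g) =
    a ^+ 2 *: (4^-1 *: (f2 *m f2)) + (2^-1 * (d / a - 3 / 2 * (b / a) ^+ 2))%:M.
Proof.
move=> a0 ff f1f ff1 f11 f2f ff2 f21 /=.
set b' := - (b / a); set c := - (d / _ - _).
(* The products f1 f2 and f2 f1 cancel, as do f f1 and f1 f, while f f2 + f2 f = -2I and f1 f1 = I.
   Only f2 f2 and scalars survive. *)
have -> : (a *: f2 + b' *: f1 + c *: f) *m (a *: f2 + b' *: f1 + c *: f) =
    a ^+ 2 *: (f2 *m f2) + (b' ^+ 2 - 2 * a * c)%:M.
  rewrite !(mulmxDl, mulmxDr) -!scalemxAl -!scalemxAr.
  rewrite ff f1f ff1 f11 f2f ff2 f21 -scalemx1.
  apply/matrixP => i j; rewrite !mxE.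
  (* The sums are entries of the only two matrix products left, f1 f2 and f2 f2. *)
  set x := \sum_k _; set y := \sum_k _; ring.
rewrite scalerDr !scalerA mulrC; congr (_ + _).
(* Here b'^2 - 2ac = 2d/a - 3(b/a)^2, twice the Schwarzian expression; the factor 1/4 leaves one
   half of it. *)
by rewrite scale_scalar_mx; congr _%:M; rewrite /b' /c; field.
Qed.

(** * Relations between the fundamental endomorphism and its first two derivatives *)

Section identities.
Variables (l : R -> {vspace 'cV[R]_(n + n)}) (hl : fanning_curve l).
Let F := fundamental l.
Let F1 := derive1 F.
Let F2 := derive1 F1.

Lemma is_derive_fundamental t : is_derive t 1 F (F1 t).
Proof. exact: smooth_is_derive (smooth_fundamental hl) t. Qed.

Lemma is_derive_derive1_fundamental t : is_derive t 1 F1 (F2 t).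
Proof. exact: smooth_is_derive (smooth_derive1 (smooth_fundamental hl)) t. Qed.

(** Differentiating FA = 0 gives F'A + FA' = 0, and FA' = A. *)
Lemma derive1_fundamental_frame A t : frame_of l A -> F1 t *m A t = - A t.
Proof.
move=> lA; have [[sA _] _] := lA.
have [_ FA'] := fundamental_frame t lA.
apply/eqP; rewrite -addr_eq0 -{2}FA'; apply/eqP.
apply: (is_derive_uniq (f := fun x => F x *m A x) (t := t)).
  apply: is_derive_mulmx; first exact: is_derive_fundamental.
  exact: smooth_is_derive sA t.
rewrite (_ : (fun x => _) = fun=> 0); first exact: is_derive_cst.
by apply/funext => x; have [] := fundamental_frame x lA.
Qed.

Lemma fundamental_sqr t : F t *m F t = 0.
Proof.
have [A lA] := hl; have [FA FA'] := fundamental_frame t lA; have [fA _] := lA.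
apply: (fanning_frame_cancel fA (t := t)).
  by rewrite -mulmxA FA mulmx0 mul0mx.
by rewrite -mulmxA FA' FA mul0mx.
Qed.

(** Checked on the basis (A|A'): both sides kill A, and F'FA' = F'A = -A = -FA'. *)
Lemma mulmx_derive1_fundamental t : F1 t *m F t = - F t.
Proof.
have [A lA] := hl; have [FA FA'] := fundamental_frame t lA; have [fA _] := lA.
apply: (fanning_frame_cancel fA (t := t)).
  by rewrite -mulmxA mulNmx FA mulmx0 oppr0.
by rewrite -mulmxA mulNmx FA' (derive1_fundamental_frame _ lA).
Qed.

Lemma mulmx_fundamental_derive1 t : F t *m F1 t = F t.
Proof.
have : F1 t *m F t + F t *m F1 t = 0.
  apply: (is_derive_uniq (f := fun x => F x *m F x) (t := t)).
    by apply: is_derive_mulmx; exact: is_derive_fundamental.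
  rewrite (_ : (fun x => _) = fun=> 0); first exact: is_derive_cst.
  by apply/funext => x; rewrite fundamental_sqr.
by rewrite mulmx_derive1_fundamental addrC => /eqP; rewrite subr_eq0 => /eqP.
Qed.

Lemma derive1_fundamental_sqr t : F1 t *m F1 t = 1%:M.
Proof.
have [A lA] := hl; have [FA FA'] := fundamental_frame t lA; have [fA _] := lA.
have F1A := derive1_fundamental_frame _ lA.
apply: (fanning_frame_cancel fA (t := t)).
  by rewrite -mulmxA F1A mulmxN F1A opprK mul1mx.
have [sA _] := fA.
(* Obtained by differentiating FA' = A. Applying F' once more and using F'F = -F, the two terms in
   FA'' cancel. *)
have F1A' : F1 t *m derive1 A t = derive1 A t - F t *m derive1 (derive1 A) t.
  apply/eqP; rewrite eq_sym subr_eq eq_sym; apply/eqP.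
  apply: (is_derive_uniq (f := fun x => F x *m derive1 A x) (t := t)).
    apply: is_derive_mulmx; first exact: is_derive_fundamental.
    exact: smooth_is_derive (smooth_derive1 sA) t.
  rewrite (_ : (fun x => _) = A); first exact: smooth_is_derive sA t.
  by apply/funext => x; have [] := fundamental_frame x lA.
rewrite mul1mx -mulmxA F1A' mulmxBr F1A' mulmxA.
by rewrite mulmx_derive1_fundamental mulNmx opprK subrK.
Qed.

(** Differentiating F'F = -F gives F''F + F'^2 = -F', with F'^2 = I. *)
Lemma mulmx_derive2_fundamental t : F2 t *m F t = - F1 t - 1%:M.
Proof.
apply/eqP; rewrite eq_sym subr_eq eq_sym; apply/eqP.
rewrite -(derive1_fundamental_sqr t).
apply: (is_derive_uniq (f := fun x => F1 x *m F x) (t := t)).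
  apply: is_derive_mulmx; first exact: is_derive_derive1_fundamental.
  exact: is_derive_fundamental.
rewrite (_ : (fun x => _) = - F); first exact/is_deriveN/is_derive_fundamental.
by apply/funext => x; rewrite mulmx_derive1_fundamental.
Qed.

Lemma mulmx_fundamental_derive2 t : F t *m F2 t = F1 t - 1%:M.
Proof.
apply/eqP; rewrite eq_sym subr_eq addrC eq_sym; apply/eqP.
rewrite -(derive1_fundamental_sqr t).
apply: (is_derive_uniq (f := fun x => F x *m F1 x) (t := t)).
  apply: is_derive_mulmx; first exact: is_derive_fundamental.
  exact: is_derive_derive1_fundamental.
rewrite (_ : (fun x => _) = F); first exact/is_derive_fundamental.
by apply/funext => x; rewrite mulmx_fundamental_derive1.
Qed.

Lemma derive2_fundamental_anticomm t : F2 t *m F1 t = - (F1 t *m F2 t).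
Proof.
apply/eqP; rewrite -addr_eq0; apply/eqP.
apply: (is_derive_uniq (f := fun x => F1 x *m F1 x) (t := t)).
  by apply: is_derive_mulmx; exact: is_derive_derive1_fundamental.
rewrite (_ : (fun x => _) = fun=> 1%:M); first exact: is_derive_cst.
by apply/funext => x; rewrite derive1_fundamental_sqr.
Qed.

(** * Invariance of the decomposition into vertical and horizontal subspaces *)

Lemma jacobi_comm t :
  jacobi l t *m vertical_proj l t = vertical_proj l t *m jacobi l t.
Proof.
rewrite /jacobi /vertical_proj -scalemxAl -!scalemxAr -scalemxAl.
do 2!congr (_ *: _); rewrite mulmxBr mulmxBl mulmx1 mul1mx; congr (_ - _).
rewrite -[derive1n 2 _]/F2 -/F -/F1.
move: (F1 t) (F2 t) (derive2_fundamental_anticomm t) => f1 f2 f21.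
(* Moving F' across each of the two factors F'' changes the sign, so F''^2 commutes with F'. *)
by rewrite -mulmxA f21 mulmxN mulmxA f21 mulNmx opprK mulmxA.
Qed.

(** Vectors of l are fixed by P since F'A = -A; conversely Pv = -FF''v/2 lies in the image of F,
    which is contained in l. *)
Lemma memv_fanning_curve t v : (v \in l t) = (vertical_proj l t *m v == v).
Proof.
have [A lA] := hl; have [_ ->] := lA.
rewrite /vertical_proj -/F -/F1; apply/memv_colspanP/eqP => [[w ->]|<-].
  rewrite mulmxA -scalemxAl mulmxBl mul1mx (derive1_fundamental_frame _ lA).
  congr (_ *m w).
  by rewrite opprK scale_half_double.
have -> : 1%:M - F1 t = - (F t *m F2 t).
  by rewrite mulmx_fundamental_derive2 opprB.
rewrite -[F t]/(fundamental l t) (fundamental_frameE _ lA).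
(* Since F = (O|A)V, only the lower half of [V] contributes: F = A [dsubmx V]. The witness is then
   the coordinate vector of -FF''v/2 in the frame A. *)
set V := invmx _; exists (- (2^-1 *: (dsubmx V *m F2 t *m v))).
rewrite -[V]vsubmxK mul_row_col mul0mx add0r col_mxKd.
by rewrite mulmxN -scalemxAr -scalerN -scalemxAl mulNmx !mulmxA.
Qed.

Lemma memv_horizontal t v :
  (v \in horizontal l t) = (vertical_proj l t *m v == 0).
Proof. by rewrite memv_ker mxhomE. Qed.

Lemma vertical_proj_idem t :
  vertical_proj l t *m vertical_proj l t = vertical_proj l t.
Proof.
rewrite /vertical_proj -/F -/F1 -scalemxAl -scalemxAr mulmxBl mul1mx mulmxBr.
by rewrite derive1_fundamental_sqr mulmx1 opprB scale_half_double.
Qed.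

Lemma fanning_decomposition t :
  [/\ (l t + horizontal l t)%VS = fullv,
      directv (l t + horizontal l t)%VS,
      (mxhom (jacobi l t) @: l t <= l t)%VS
    & (mxhom (jacobi l t) @: horizontal l t <= horizontal l t)%VS].
Proof.
split.
- apply/eqP; rewrite eqEsubv subvf /=; apply/subvP => v _.
  (* The splitting v = Pv + (v - Pv) defined by the idempotent P. *)
  rewrite -[v](subrK (vertical_proj l t *m v)) addrC memv_add //.
    by rewrite memv_fanning_curve mulmxA vertical_proj_idem.
  by rewrite memv_horizontal mulmxBr mulmxA vertical_proj_idem subrr.
- apply/directv_addP/eqP; rewrite -subv0; apply/subvP => v.
  rewrite memv_cap memv_fanning_curve memv_horizontal memv0.
  by case/andP => /eqP -> .
- apply/subvP => _ /memv_imgP[v + ->]; rewrite mxhomE !memv_fanning_curve.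
  by rewrite mulmxA -jacobi_comm -mulmxA => /eqP ->.
- apply/subvP => _ /memv_imgP[v + ->]; rewrite mxhomE !memv_horizontal.
  by rewrite mulmxA -jacobi_comm -mulmxA => /eqP ->; rewrite mulmx0.
Qed.

(** * Equivariance under invertible linear maps *)

Lemma jacobi_mulmx T t : T \in unitmx ->
  jacobi (fun u => (mxhom T @: l u)%VS) t = T *m jacobi l t *m invmx T.
Proof.
move=> uT; have [A lA] := hl; have [[sA uA] lE] := lA.
have dTA x : derive1 (fun y => T *m A y) x = T *m derive1 A x.
  exact: derive1_is_derive (is_derive_mulmxl T (smooth_is_derive sA x)).
have lTA : frame_of (fun u => (mxhom T @: l u)%VS) (fun u => T *m A u).
  split=> [|u]; last by rewrite lE colspan_mulmx.
  split=> [|u]; last by rewrite dTA -mul_mx_row unitmx_mul uT uA.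
  by apply/smoothP => k; apply: ck_mulmx; [exact: ck_cst|exact: smooth_ck sA].
have -> : jacobi (fun u => (mxhom T @: l u)%VS) t = 4^-1 *:
    ((T *m F2 t *m invmx T) *m (T *m F2 t *m invmx T)).
  (* T F T^-1 kills TA and sends TA' to TA, so uniqueness applies with the frame TA. *)
  have FT : fundamental (fun u => (mxhom T @: l u)%VS) =
      fun u => T *m F u *m invmx T.
    apply/funext => u; have [FA FA'] := fundamental_frame u lA.
    apply: (fundamental_unique lTA); rewrite ?dTA mulmxA mulmxKV //.
      by rewrite -mulmxA FA mulmx0.
    by rewrite -mulmxA FA'.
  have F1T : derive1 (fundamental (fun u => (mxhom T @: l u)%VS)) =
      fun u => T *m F1 u *m invmx T.
    apply/funext => u; rewrite FT; apply: derive1_is_derive.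
    exact: is_derive_mulmxr (is_derive_mulmxl T (is_derive_fundamental u)).
  rewrite /jacobi derive1nS derive1n1 F1T.
  have dF1 := is_derive_mulmxl T (is_derive_derive1_fundamental t).
  by rewrite (derive1_is_derive (is_derive_mulmxr (invmx T) dF1)).
rewrite /jacobi -[derive1n 2 _]/F2 -scalemxAr -scalemxAl; congr (_ *: _).
by rewrite !mulmxA mulmxKV.
Qed.

(** * Change of parameter *)

Section reparametrization.
Variables (s : R -> R) (hs : diffeomorphism s).

(** Differentiating g(s(t)) = t gives g'(s(t)) s'(t) = 1. *)
Lemma diffeomorphism_derive1_neq0 t : derive1 s t != 0.
Proof.
have [ss [g [sg sK _]]] := hs.
have dgs := is_derive1_comp (smooth_is_derive sg (s t)) (smooth_is_derive ss t).
have /(is_derive_uniq dgs) E : is_derive t 1 (g \o s) 1.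
  by rewrite (_ : g \o s = id); [exact: is_derive_id|exact/funext].
by apply/eqP => s0; move: E; rewrite s0 mulr0 => /esym/eqP; rewrite oner_eq0.
Qed.

Lemma frame_comp A : frame_of l A ->
  frame_of (fun u => l (s u)) (fun u => A (s u)) /\
  forall u, derive1 (fun x => A (s x)) u = derive1 s u *: derive1 A (s u).
Proof.
move=> [[sA uA] lE]; have [ss _] := hs.
have dAs u : derive1 (fun x => A (s x)) u = derive1 s u *: derive1 A (s u).
  apply: derive1_is_derive.
  exact: is_derive_comp_mx (smooth_is_derive sA (s u)) (smooth_is_derive ss u).
split; last exact: dAs.
split=> [|u]; last exact: lE.
split=> [|u].
  apply/smoothP => k; apply/ck_mxP => i j.
  have /ck_mxP/(_ i j) cA := smooth_ck k sA.
  exact: ck_comp cA (smooth_ck k ss).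
(* The new juxtaposed matrix is the old one at s(u) times diag(I, s'I), whose determinant is a power
   of s'. *)
rewrite dAs; have -> : row_mx (A (s u)) (derive1 s u *: derive1 A (s u)) =
    row_mx (A (s u)) (derive1 A (s u)) *m block_mx 1%:M 0 0 (derive1 s u)%:M.
  by rewrite mul_row_block !mulmx0 mulmx1 addr0 add0r mul_mx_scalar.
rewrite unitmx_mul uA unitmxE det_ublock det1 mul1r det_scalar unitfE.
by rewrite expf_neq0 // diffeomorphism_derive1_neq0.
Qed.

(** The factor 1/s' compensates the s' that the chain rule puts in front of A'(s). *)
Lemma fundamental_comp :
  fundamental (fun u => l (s u)) = fun u => (derive1 s u)^-1 *: F (s u).
Proof.
have [A lA] := hl; have [lAs dAs] := frame_comp lA.
apply/funext => u; have [FA FA'] := fundamental_frame (s u) lA.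
apply: (fundamental_unique lAs); first by rewrite -scalemxAl FA scaler0.
rewrite dAs -scalemxAl -scalemxAr scalerA mulVf ?scale1r //.
exact: diffeomorphism_derive1_neq0.
Qed.

Lemma jacobi_comp t : jacobi (fun u => l (s u)) t =
  (derive1 s t) ^+ 2 *: jacobi l (s t) + (2^-1 * schwarzian s t)%:M.
Proof.
have [ss _] := hs; have s0 := diffeomorphism_derive1_neq0.
pose s1 := derive1 s; pose s2 := derive1 s1; pose s3 := derive1 s2.
have ds (u : R) : is_derive u 1 s (s1 u) := smooth_is_derive ss u.
have ds1 (u : R) : is_derive u 1 s1 (s2 u).
  exact: smooth_is_derive (smooth_derive1 ss) u.
have ds2 (u : R) : is_derive u 1 s2 (s3 u).
  exact: smooth_is_derive (smooth_derive1 (smooth_derive1 ss)) u.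
have dV (u : R) : is_derive u 1 (fun x => (s1 x)^-1) (- (s1 u) ^- 2 * s2 u).
  exact: is_deriveV (s0 u) (ds1 u).
(* The chain-rule factor s' cancels 1/s' in front of F'(s). The other coefficient, -s''/s'^2, is
   written as a product so that [is_derive_mul] and [dV] differentiate it. *)
have E1 : derive1 (fundamental (fun u => l (s u))) =
    fun u => F1 (s u) + (- (s2 u * ((s1 u)^-1 * (s1 u)^-1))) *: F (s u).
  apply/funext => u; rewrite fundamental_comp; apply: derive1_is_derive.
  apply: is_derive_eq.
    exact: is_derive_scalemx (dV u)
      (is_derive_comp_mx (is_derive_fundamental (s u)) (ds u)).
  rewrite scalerA mulVf ?s0 // scale1r addrC; congr (_ + _ *: _).
  by rewrite mulNr mulrC expr2 invfM.
(* The derivative of -s''/s'^2. *)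
pose c := - (s3 t / s1 t ^+ 2 - 2 * s2 t ^+ 2 / s1 t ^+ 3).
have E2 : derive1n 2 (fundamental (fun u => l (s u))) t =
    s1 t *: F2 (s t) + (- (s2 t / s1 t)) *: F1 (s t) + c *: F (s t).
  rewrite derive1nS derive1n1 E1; apply: derive1_is_derive.
  have dF := is_derive_comp_mx (is_derive_fundamental (s t)) (ds t).
  have dF1 := is_derive_comp_mx (is_derive_derive1_fundamental (s t)) (ds t).
  have dc := is_deriveN (is_derive_mul (ds2 t) (is_derive_mul (dV t) (dV t))).
  apply: is_derive_eq; first exact: is_deriveD dF1 (is_derive_scalemx dc dF).
  rewrite -!addrA; congr (_ + _); rewrite addrC scalerA; congr (_ *: _ + _ *: _).
    by rewrite /c; field; exact: s0.
  by rewrite -[X in X * _]/(- (s2 t * ((s1 t)^-1 / s1 t))); field; exact: s0.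
rewrite {1}/jacobi E2 /jacobi -[derive1n 2 (fundamental l)]/F2 /schwarzian.
rewrite -[derive1n 3 s]/s3 -[derive1n 2 s]/s2 -/s1.
apply: reparametrized_square; first exact: s0.
- exact: fundamental_sqr.
- exact: mulmx_derive1_fundamental.
- exact: mulmx_fundamental_derive1.
- exact: derive1_fundamental_sqr.
- exact: mulmx_derive2_fundamental.
- exact: mulmx_fundamental_derive2.
- exact: derive2_fundamental_anticomm.
Qed.

End reparametrization.
End identities.
End fanning.

Theorem theorem1p4 (R : realType) (n : nat)
    (l : R -> {vspace 'cV[R]_(n + n)}) (hl : fanning_curve l) :
  [/\
      forall t : R,
        [/\ (l t + horizontal l t)%VS = fullv,
            directv (l t + horizontal l t)%VS,
            (mxhom (jacobi l t) @: l t <= l t)%VS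
          & (mxhom (jacobi l t) @: horizontal l t <= horizontal l t)%VS],
      forall T : 'M[R]_(n + n), T \in unitmx ->
        forall t : R,
          jacobi (fun u => (mxhom T @: l u)%VS) t
            = T *m jacobi l t *m invmx T
    &
      forall s : R -> R, diffeomorphism s ->
        forall t : R,
          jacobi (fun u => l (s u)) t
            = (derive1 s t) ^+ 2 *: jacobi l (s t)
              + (2^-1 * schwarzian s t)%:M].
Proof.
split=> [t|T uT t|s hs t].
- exact: fanning_decomposition.
- exact: jacobi_mulmx.
- exact: jacobi_comp.
Qed.
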